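(* Let $G$ be a group and let $X$ be a limit aperiodic $G$-set on which $G$ acts transitively. If the stabilizer $\mathrm{Stab}_G(x)=\{g\in G\mid gx=x\}$ is a limit aperiodic group for some $x\in X$ (so that $X=\mathrm{Orb}_G(x)$), then $G$ is a limit aperiodic group.
   Context: Let a group $G$ (not necessarily finitely generated) act on a set $X$ (a $G$-set), and let $F$ be a finite set (of ''colors'') with the discrete topology. The set $F^X$ of all maps $X\to F$ carries the product topology and the $G$-action $(g\ast f)(x)=f(g^{-1}x)$. For $f\in F^X$ let $\overline{\mathrm{Orb}_G(f)}$ be the closure of its $G$-orbit in $F^X$. Let $\mathrm{Fix}_G(X)=\{g\in G: gx=x \text{ for all } x\in X\}$ be the kernel of the action. A map $f\in F^X$ is called limit aperiodic if for every $\phi\in\overline{\mathrm{Orb}_G(f)}$ and every $a\in G$, $a\ast\phi=\phi$ implies $a\in \mathrm{Fix}_G(X)$. $X$ is a limit aperiodic $G$-set if there exist a finite set $F$ and a limit aperiodic map $f:X\to F$. A group $G$ is a limit aperiodic group if $G$ is a limit aperiodic $G$-set under the action on itself by left multiplication; i.e. there are a finite set $F$ and $f:G\to F$ such that for every $\phi\in\overline{\mathrm{Orb}_G(f)}\subset F^G$, $b\ast\phi=\phi$ implies $b=e$. *)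

(* Defs.v *)
From HB Require Import structures.
From mathcomp Require Import all_boot.
From mathcomp Require Import boolp classical_sets topology.

Set Implicit Arguments.
Unset Strict Implicit.
Unset Printing Implicit Defensive.

Local Open Scope classical_set_scope.
Local Open Scope group_scope.

(* The actions of MathComp's [action.v] are right actions of finite groups;
   here groups are arbitrary and act on the left. *)
Record gaction (G : groupType) (X : Type) := GAction {
  act :> G -> X -> X;
  act1 : forall x, act 1 x = x;
  actM : forall g h x, act (g * h) x = act g (act h x)
}.

Definition lmul_action (G : groupType) : gaction G G :=
  @GAction G G mul (@mul1g G) (fun g h x => esym (@mulgA G g h x)).

Section Action.
Variables (G : groupType) (X : Type) (to : gaction G X).

Definition transitive_action : Prop := forall x y, exists g, to g x = y.

Definition fix_act : set G := [set g | forall x, to g x = x].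

Definition stab (x : X) : set G := [set g | to g x = x].

Record stab_group (x : X) := StabGroup {
  stab_val :> G;
  stab_valP : stab_val \in stab x
}.

HB.instance Definition _ (x : X) := [isSub for @stab_val x].
HB.instance Definition _ (x : X) := [Choice of stab_group x by <:].

Lemma stab_group_closed (x : X) : group_closed (mem (stab x)).
Proof.
split=> [|g h /set_mem gx /set_mem hx]; apply/mem_set; first exact: act1.
by rewrite /stab /= -[in LHS]hx -actM -mulgA mulVg mulg1.
Qed.

HB.instance Definition _ (x : X) :=
  SubChoice_isSubGroup.Build G _ (stab_group x) (stab_group_closed x).

Section Colorings.
Variable F : finType.

Local Notation coloring := {ptws X -> discrete_topology F}.

Definition shift (g : G) (f : coloring) : coloring := fun x => f (to g^-1 x).

Definition orbit_closure (f : coloring) : set coloring :=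
  closure (range (shift ^~ f)).

Definition limit_aperiodic_map (f : coloring) : Prop :=
  forall phi, orbit_closure f phi ->
  forall a, shift a phi = phi -> fix_act a.

End Colorings.

Definition limit_aperiodic : Prop :=
  exists (F : finType) (f : X -> F), limit_aperiodic_map f.

End Action.

Definition limit_aperiodic_group (G : groupType) : Prop :=
  limit_aperiodic (lmul_action G).

Lemma fix_lmul_action (G : groupType) : fix_act (lmul_action G) = [set 1].
Proof.
apply/seteqP; split=> [g /(_ 1)|g -> x] /=; last exact: mul1g.
by rewrite mulg1.
Qed.

(* Main.v *)
(* Colour G by f(g) = (psi(g x), chi(s(g x)^-1 g)), where psi colours X, chi
   colours the stabilizer H of x, and s is a section of g |-> g x.  The first
   coordinate of a limit phi of f factors through a limit of psi, so a period
   b of phi acts trivially on X; in particular b lies in H.  The second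
   coordinate of phi restricted to H is a limit of chi with period b, so b is
   trivial. *)
Require Import Defs.
From mathcomp Require Import all_boot.
From mathcomp Require Import boolp classical_sets filter topology.

Set Implicit Arguments.
Unset Strict Implicit.
Unset Printing Implicit Defensive.

Local Open Scope classical_set_scope.
Local Open Scope group_scope.

Lemma closure_preimage (T U : topologicalType) (f : T -> U) (A : set T)
  (B : set U) :
  continuous f -> A `<=` f @^-1` B -> closure A `<=` f @^-1` closure B.
Proof. by move=> cf AB p Ap V /cf /Ap [q [/AB Bq Vq]]; exists (f q). Qed.

Lemma ptws_eval_continuous (X : Type) (T : topologicalType) (x : X) :
  continuous (fun f : {ptws X -> T} => f x).
Proof.
move=> f; have /cvg_sup/(_ x) fx : f --> f by exact: cvg_id.
by move=> A /initial_continuous /fx.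
Qed.

(** The pointwise topology is the supremum of the topologies induced by evaluations, so continuity
    is tested at each [y], where the map is [u] after evaluation at [p y]. *)
Lemma ptws_comp_continuous (X Y : Type) (T U : topologicalType) (p : Y -> X)
  (u : T -> U) :
  continuous u ->
  continuous (fun (f : {ptws X -> T}) => (fun y => u (f (p y))) : {ptws Y -> U}).
Proof.
move=> cu f; apply/cvg_sup.
  exact/fmap_filter/(nbhs_filter (f : {ptws X -> T})).
move=> y V [_ [[B oB <-] Bf BV]].
have /cu /(@ptws_eval_continuous X T (p y) f) : nbhs (u (f (p y))) B.
  exact: open_nbhs_nbhs.
by rewrite !nbhs_simpl; apply: (@filterS _ (nbhs f)) => g; exact: BV.
Qed.

Lemma discrete_continuous (T : choiceType) (U : topologicalType) (u : T -> U) :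
  continuous (u : discrete_topology T -> U).
Proof.
move=> t A /nbhs_singleton At.
by rewrite nbhs_simpl/= nbhs_principalE; apply/principal_filterP.
Qed.

(** The hypothesis says that the continuous map [g |-> u \o g \o p] carries the orbit of [f] into
    that of [h]; closures follow. *)
Lemma orbit_closure_comp (G H : groupType) (X Y : Type) (to : gaction G X)
  (to' : gaction H Y) (E F : finType) (f : X -> E) (h : Y -> F) (p : Y -> X)
  (u : E -> F) (phi : X -> E) :
  (forall g, exists k, forall y, u (f (to g^-1 (p y))) = h (to' k^-1 y)) ->
  orbit_closure to f phi -> orbit_closure to' h (u \o phi \o p).
Proof.
move=> fh; pose DE := discrete_topology E; pose DF := discrete_topology F.
apply: (@closure_preimage {ptws X -> DE} {ptws Y -> DF}
  (fun g => u \o g \o p)).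
  apply: (@ptws_comp_continuous X Y DE DF).
  exact: (@discrete_continuous E DF).
move=> _ [g _ <-]; have [k hk] := fh g.
by exists k => //; apply/funext => y; exact/esym/hk.
Qed.

(** As [F] is discrete, some translate of [f] agrees with [phi] at both [x] and [y]. *)
Lemma orbit_closure_eq (G : groupType) (X A : Type) (to : gaction G X)
  (F : finType) (f : X -> F) (u : F -> A) (x y : X) (phi : X -> F) :
  (forall g, u (f (to g x)) = u (f (to g y))) ->
  orbit_closure to f phi -> u (phi x) = u (phi y).
Proof.
move=> fxy.
have nbhsx z : nbhs (phi : {ptws X -> discrete_topology F})
    [set psi : {ptws X -> discrete_topology F} | psi z = phi z].
  apply: (@ptws_eval_continuous X (discrete_topology F) z phi
    [set c | c = phi z]).
  by rewrite nbhs_principalE; apply/principal_filterP.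
move=> /(_ _ (filterI (nbhsx x) (nbhsx y))).
by move=> [_ [[g _ <-] /= [<- <-]]]; exact: fxy.
Qed.

Theorem theorem3p4 (G : groupType) (X : Type) (to : gaction G X)
  (laX : limit_aperiodic to) (trX : transitive_action to)
  (laS : exists x : X, limit_aperiodic_group (stab_group to x)) :
  limit_aperiodic_group G.
Proof.
have [E [psi psiP]] := laX; have [x [F [chi chiP]]] := laS.
have [s sx] := choice (trX x).
have rP g : (s (to g x))^-1 * g \in stab to x.
  by apply/mem_set; rewrite /stab /= actM -{2}(sx (to g x)) -actM mulVg act1.
pose r g := StabGroup (rP g).
exists (E * F)%type, (fun g => (psi (to g x), chi (r g))) => phi phi_lim b bphi.
have bphiE g : phi (b^-1 * g) = phi g by rewrite -{2}bphi.
have phi1 g g' : to g x = to g' x -> (phi g).1 = (phi g').1.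
  move=> gg'; apply: orbit_closure_eq phi_lim => k /=.
  by rewrite !actM gg'.
have bX : fix_act to b.
  apply: psiP; first apply: (orbit_closure_comp (p := s) (u := fst)) phi_lim.
    by move=> g; exists g => y /=; rewrite actM sx.
  (* Both [s (to b^-1 y)] and [b^-1 * s y] send [x] to [to b^-1 y]. *)
  apply/funext => y; rewrite /shift /= -(bphiE (s y)); apply: phi1.
  by rewrite actM !sx.
have bS : b \in stab to x by apply/mem_set; exact: bX.
have : fix_act (lmul_action (stab_group to x)) (StabGroup bS).
  apply: chiP.
    apply: (orbit_closure_comp (p := @stab_val _ _ to x) (u := snd)) phi_lim.
    (* Since [y] fixes [x], [g^-1 * y] and [g^-1] move [x] to the same point and share a section
       value, whence [r (g^-1 * y) = r g^-1 * y]. *)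
    move=> g; exists (r g^-1)^-1 => y /=; congr chi; apply: val_inj.
    rewrite invgK gmulfM /= actM.
    by have /set_mem -> := stab_valP y; rewrite mulgA.
  by apply/funext => y; rewrite /shift /= bphiE.
by rewrite !fix_lmul_action => /(congr1 (@stab_val _ _ to x)) /= ->.
Qed.
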